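(* Let $n\ge1$ and $d\in\mathbb{N}$, define $N$ by $N(n,d)=N+1$, and let $p>0$ be a real number with $p\le d$. Let $\{r_k\}_{k\in\mathbb{N}}$ be a sequence of positive reals and $A_k=\{\mathbf{a}^k_0,\dots,\mathbf{a}^k_N\}\subset\mathbb{R}^n$ ($k\in\mathbb{N}$) sets of $N+1$ distinct points. Suppose that: (1) $A_k$ is contained in the closed ball of radius $r_k$ centred at $\mathbf{a}^k_0$; (2) $\lim_{k\to\infty}r_k=0$; (3) $\lim_{k\to\infty}\mathbf{a}^k_0=\mathbf{0}$; (4) there exist $c,e>0$ such that $|\operatorname{Det}V(A_k)|\ge c\cdot r_k^{e}$ for all $k\in\mathbb{N}$. Let $f$ be a $C^d$ function defined in a neighbourhood of $\mathbf{0}$, and put $S_k:=r_k^{-p}\max\{|f(\mathbf{x})|:\mathbf{x}\in A_k\}$ and $m:=p-\bigl(e-n\cdot N(n+1,d-1)\bigr)$. Then: (i) if $m$ is an integer and $\lim_{k\to\infty}S_k=0$, then $f$ is $m$-flat at $\mathbf{0}$; (ii) if $m$ is not an integer and $(S_k)$ is bounded, then $f$ is $[m]$-flat at $\mathbf{0}$, where $[m]$ is the largest integer not greater than $m$.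
   Context: $N(n,d):=\binom{n+d}{d}$ (with $N(m,-1):=0$). $I(n,d)$ is the set of multi-indices $\mathbf{j}\in\mathbb{Z}_{\ge0}^n$ with $|\mathbf{j}|=j_1+\dots+j_n\le d$, and $\mathbf{x}^{\mathbf{j}}=x_1^{j_1}\cdots x_n^{j_n}$. For a set $A=\{\mathbf{a}_0,\dots,\mathbf{a}_N\}$ of $N(n,d)$ points, with orderings of $A$ and $I(n,d)=\{\mathbf{j}_0,\dots,\mathbf{j}_N\}$ fixed, $V(A)=(\mathbf{a}_i^{\mathbf{j}_l})_{0\le i,l\le N}$ is the Vandermonde matrix; $|\operatorname{Det}V(A)|$ is independent of the orderings. For an integer $k\le d$, a $C^d$ function $f$ near $\mathbf{0}$ is $k$-flat at $\mathbf{0}$ if $\partial^{|\mathbf{q}|}f/\partial\mathbf{x}^{\mathbf{q}}(\mathbf{0})=0$ for all multi-indices $\mathbf{q}$ with $|\mathbf{q}|\le k$. *)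

(* Defs.v *)
From HB Require Import structures.
From mathcomp Require Import all_boot all_order all_algebra.
From mathcomp Require Import all_classical all_reals all_analysis.
Set Implicit Arguments. Unset Strict Implicit. Unset Printing Implicit Defensive.
Import Order.TTheory GRing.Theory Num.Theory.
Import numFieldNormedType.Exports.
Local Open Scope classical_set_scope.
Local Open Scope ring_scope.

Definition Nbin (m : nat) (d : int) : nat :=
  match d with Posz d' => 'C(m + d', d') | Negz _ => 0%N end.

Definition monom {R : realType} {n : nat} (x : 'rV[R]_n) (j : 'I_n -> nat) : R :=
  \prod_(i < n) (x ord0 i) ^+ (j i).

Definition multi_indices (n d : nat) : seq {ffun 'I_n -> 'I_d.+1} :=
  seq.filter (fun j : {ffun 'I_n -> 'I_d.+1} => (\sum_(i < n) nat_of_ord (j i) <= d)%N)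
    (enum {ffun 'I_n -> 'I_d.+1}).

Definition vandermonde {R : realType} (n d N : nat) (A : 'I_N.+1 -> 'rV[R]_n)
  : 'M[R]_N.+1 :=
  \matrix_(i < N.+1, l < N.+1)
     monom (A i) (fun k => nat_of_ord (nth [ffun=> ord0] (multi_indices n d) l k)).

Definition partial {R : realType} {n : nat} (i : 'I_n) (f : 'rV[R]_n -> R)
  : 'rV[R]_n -> R :=
  fun x => derive f x (delta_mx ord0 i).

Fixpoint iter_partial {R : realType} {n : nat} (s : seq 'I_n) (f : 'rV[R]_n -> R)
  : 'rV[R]_n -> R :=
  match s with [::] => f | i :: s' => partial i (iter_partial s' f) end.

Definition partial_mi {R : realType} {n : nat} (q : 'I_n -> nat) (f : 'rV[R]_n -> R)
  : 'rV[R]_n -> R :=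
  iter_partial (flatten [seq nseq (q i) i | i <- enum 'I_n]) f.

Definition Cd_on {R : realType} {n : nat} (d : nat) (U : set 'rV[R]_n)
  (f : 'rV[R]_n -> R) : Prop :=
  (forall (s : seq 'I_n) (i : 'I_n) x, (size s < d)%N -> U x ->
      derivable (iter_partial s f) x (delta_mx ord0 i)) /\
  (forall (s : seq 'I_n) x, (size s <= d)%N -> U x ->
      {for x, continuous (iter_partial s f)}).

Definition flat_at0 {R : realType} {n : nat} (k : int) (f : 'rV[R]_n -> R) : Prop :=
  forall q : 'I_n -> nat, ((\sum_(i < n) q i)%:Z <= k) -> partial_mi q f 0 = 0.

Definition enorm {R : realType} {n : nat} (x : 'rV[R]_n) : R :=
  Num.sqrt (\sum_(i < n) (x ord0 i) ^+ 2).

(* Main.v *)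
Require Import Defs.
From HB Require Import structures.
From mathcomp Require Import all_boot all_order all_algebra.
From mathcomp Require Import all_classical all_reals all_analysis.
From mathcomp Require Import fingroup perm zify ring lra.
Set Implicit Arguments. Unset Strict Implicit. Unset Printing Implicit Defensive.
Import Order.TTheory GRing.Theory Num.Theory.
Import numFieldNormedType.Exports.
Local Open Scope classical_set_scope.
Local Open Scope ring_scope.

(* Put b_k = a^k_0, E = n N(n+1,d-1) and let Y_k be the image of A_k under
   x |-> (x - b_k) / r_k, a subset of the unit ball. Translations do not change the
   Vandermonde determinant and E is the sum of the degrees of all multi-indices in I(n,d),
   so Det V(A_k) = r_k^E Det V(Y_k) and hence |Det V(Y_k)| >= c r_k^(e - E); boundedness
   of Det V(Y_k) forces e >= E.
   The Taylor polynomial of f of degree d at b_k, in the variable (x - b_k) / r_k, takes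
   at the points of Y_k values bounded by r_k^p (S_k + o(1)). Solving for its coefficients
   by Cramer's rule bounds r_k^|q| |D^q f(b_k)| by a constant times
   r_k^(p - (e - E)) (S_k + o(1)) = r_k^m (S_k + o(1)). Divide by r_k^|q| and let k tend
   to infinity. *)

(** * Multi-indices of degree at most [d]: their number and their total degree *)

Lemma mem_multi_indices n d (j : {ffun 'I_n -> 'I_d.+1}) :
  (j \in multi_indices n d) = (\sum_(i < n) j i <= d)%N.
Proof. by rewrite mem_filter mem_enum andbT. Qed.

Lemma multi_indices_uniq n d : uniq (multi_indices n d).
Proof. by rewrite filter_uniq // enum_uniq. Qed.

Lemma size_multi_indices n d : size (multi_indices n d) = 'C(n + d, d).
Proof.
have := card_partial_ord_partitions n d; rewrite -bin_sub ?leq_addr // addKn => <-.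
rewrite /multi_indices size_filter -sum1_count big_enum_cond /= -sum1dep_card.
rewrite (reindex (fun t : n.-tuple 'I_d.+1 => [ffun i => tnth t i])) /=.
  apply: eq_bigl => t; rewrite big_tuple.
  by congr (_ <= _)%N; apply: eq_bigr => i _; rewrite ffunE.
exists (fun j : {ffun 'I_n -> 'I_d.+1} => [tuple j i | i < n]) => [t _|j _].
  by apply: eq_from_tnth => i; rewrite tnth_mktuple ffunE.
by apply/ffunP => i; rewrite ffunE tnth_mktuple.
Qed.

(** With d - |j| viewed as an extra coordinate that homogenizes [j] to degree [d], this swaps
    coordinate [i] with the extra one. [inord] is exact because d - |j| never exceeds [d]. *)
Definition slack {n d : nat} (i : 'I_n) (j : {ffun 'I_n -> 'I_d.+1}) :
    {ffun 'I_n -> 'I_d.+1} :=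
  [ffun k => if k == i then inord (d - \sum_(l < n) j l) else j k].

Lemma sum_slack n d (i : 'I_n) (j : {ffun 'I_n -> 'I_d.+1}) :
  (\sum_(l < n) j l <= d)%N -> (\sum_(l < n) slack i j l = d - j i)%N.
Proof.
move=> jd; rewrite (bigD1 i) //= ffunE eqxx inordK ?ltnS ?leq_subr //.
have -> : (\sum_(l < n | l != i) slack i j l = \sum_(l < n | l != i) j l)%N.
  by apply: eq_bigr => l /negbTE li; rewrite ffunE li.
by move: jd; rewrite (bigD1 i) //=; move: (\sum_(_ < n | _) _)%N => t; lia.
Qed.

Lemma slackK n d (i : 'I_n) (j : {ffun 'I_n -> 'I_d.+1}) :
  (\sum_(l < n) j l <= d)%N -> slack i (slack i j) = j.
Proof.
move=> jd; apply/ffunP => k; rewrite ffunE; case: eqP => [->|/eqP/negbTE ki].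
  apply: val_inj; rewrite /= inordK ?ltnS ?leq_subr // sum_slack // subKn //.
  by rewrite -ltnS.
by rewrite ffunE ki.
Qed.

Lemma sum_coord_multi_indices n d (i : 'I_n) :
  (\sum_(j <- multi_indices n d) j i =
   \sum_(j <- multi_indices n d) (d - \sum_(l < n) j l))%N.
Proof.
rewrite /multi_indices !big_filter !big_enum_cond /=.
rewrite [LHS](reindex_onto (slack i) (slack i)) /=; last by move=> j; exact: slackK.
apply: eq_big => [j|j _]; last by rewrite ffunE eqxx inordK ?ltnS ?leq_subr.
apply/andP/idP => [[jd /eqP <-]|jd]; last by rewrite sum_slack ?leq_subr ?slackK ?eqxx.
by rewrite sum_slack // leq_subr.
Qed.

(** Let D be the left side and T the sum of all d - |j|. The swap symmetry gives D = n T, and D + T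
    = d C(n+d, n); hence (n+1) D = n d C(n+d, n) = n (n+1) C(n+d, n+1). *)
Lemma sum_degree_multi_indices n d :
  (\sum_(j <- multi_indices n d) \sum_(i < n) j i = n * Nbin n.+1 (d%:Z - 1))%N.
Proof.
set D := LHS.
have DE : D = (n * \sum_(j <- multi_indices n d) (d - \sum_(l < n) j l))%N.
  rewrite /D exchange_big /= (eq_bigr _ (fun i _ => sum_coord_multi_indices d i)).
  by rewrite sum_nat_const card_ord.
have split_sum : (D + \sum_(j <- multi_indices n d) (d - \sum_(l < n) j l) =
    d * 'C(n + d, n))%N.
  rewrite -big_split /= big_seq (eq_bigr (fun=> d)); last first.
    by move=> j; rewrite mem_multi_indices => jd; rewrite subnKC.
  rewrite -big_seq big_const_seq count_predT iter_addn_0 size_multi_indices.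
  by rewrite -[in RHS]bin_sub ?leq_addr // addKn.
have -> : Nbin n.+1 (d%:Z - 1) = 'C(n + d, n.+1).
  (* For [d = 0] the convention N(n+1, -1) = 0 agrees with the vanishing of C(n, n+1). *)
  case: d {D DE split_sum} => [|d]; first by rewrite addn0 bin_small.
  rewrite -[d.+1%:Z]/(1 + d%:Z)%R addrAC subrr add0r /= addSnnS.
  by rewrite -[RHS]bin_sub; [congr 'C(_, _); lia|lia].
have := mul_bin_left (n + d) n; rewrite addKn => bE.
by apply/eqP; rewrite -(eqn_pmul2l (ltn0Sn n)); apply/eqP; nia.
Qed.

(** * The Vandermonde determinant under translation and scaling *)

Section MultiIndexEnumeration.
Context {n d N : nat}.
Hypothesis hN : N.+1 = 'C(n + d, d).
Local Notation mi l := (nth [ffun=> ord0] (multi_indices n d) l).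

Lemma big_multi_indices (T : Type) (idx : T) (op : Monoid.com_law idx)
    (F : {ffun 'I_n -> 'I_d.+1} -> T) :
  \big[op/idx]_(j <- multi_indices n d) F j = \big[op/idx]_(l < N.+1) F (mi l).
Proof. by rewrite (big_nth [ffun=> ord0]) size_multi_indices -hN big_mkord. Qed.

Lemma leq_degree_nth_multi_indices (l : 'I_N.+1) : (\sum_(i < n) mi l i <= d)%N.
Proof. by rewrite -mem_multi_indices mem_nth // size_multi_indices -hN. Qed.

Lemma nth_multi_indices_inj : injective (fun l : 'I_N.+1 => mi l).
Proof.
move=> l k /eqP; rewrite nth_uniq ?multi_indices_uniq ?size_multi_indices -?hN //.
by move=> /eqP/val_inj.
Qed.

Lemma nth_multi_indices_surj (j : {ffun 'I_n -> 'I_d.+1}) :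
  (\sum_(i < n) j i <= d)%N -> exists l : 'I_N.+1, mi l = j.
Proof.
rewrite -mem_multi_indices => jd.
have lt : (index j (multi_indices n d) < N.+1)%N.
  by rewrite hN -size_multi_indices index_mem.
by exists (Ordinal lt); rewrite nth_index.
Qed.

Section Vandermonde.
Context {R : realType}.

(** The range is padded to a [D] independent of [m], as distributing a product of such sums over
    index functions requires; the added terms have zero binomial coefficient. *)
Lemma exprDn_widen (x y : R) (m D : nat) : (m <= D)%N ->
  (x + y) ^+ m = \sum_(t < D.+1) (x ^+ t * y ^+ (m - t)) *+ 'C(m, t).
Proof.
move=> mD; rewrite addrC exprDn.
rewrite (big_ord_widen D.+1 (fun t => y ^+ (m - t) * x ^+ t *+ 'C(m, t))) //.
rewrite big_mkcond /=; apply: eq_bigr => t _; rewrite mulrC.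
by case: ltnP => // mt; rewrite bin_small // mulr0n.
Qed.

(** Column [k] lists the coefficients of the monomial of index [mi k] at x + b in the monomials of
    index [mi l] at x. Where the subtraction truncates, the binomial coefficient is zero. *)
Definition translation_mx (b : 'rV[R]_n) : 'M[R]_N.+1 :=
  \matrix_(l, k) \prod_(i < n) (b ord0 i ^+ (mi k i - mi l i) *+ 'C(mi k i, mi l i)).

Lemma translation_mx_neq0 (b : 'rV[R]_n) (l k : 'I_N.+1) :
  translation_mx b l k != 0 -> forall i, (mi l i <= mi k i)%N.
Proof.
rewrite mxE => /prodf_neq0 nz i; have := nz i isT; apply: contraNT.
by rewrite -ltnNge => lt; rewrite bin_small // mulr0n.
Qed.

Lemma vandermonde_translate (A : 'I_N.+1 -> 'rV[R]_n) (b : 'rV[R]_n) :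
  vandermonde d (fun i => A i + b) = vandermonde d A *m translation_mx b.
Proof.
apply/matrixP => i k; rewrite !mxE /monom.
have jd : (\sum_(s < n) mi k s <= d)%N := leq_degree_nth_multi_indices k.
rewrite (eq_bigr (fun s => \sum_(t < d.+1)
    (A i ord0 s ^+ t * b ord0 s ^+ (mi k s - t)) *+ 'C(mi k s, t))); last first.
  by move=> s _; rewrite mxE -exprDn_widen // -ltnS.
rewrite bigA_distr_bigA /=.
transitivity (\sum_(j <- multi_indices n d) \prod_(s < n)
   ((A i ord0 s ^+ j s * b ord0 s ^+ (mi k s - j s)) *+ 'C(mi k s, j s))).
  (* Nonzero binomials force [j] below [mi k] in every coordinate, so only multi-indices of degree
     at most [d] survive. *)
  rewrite /multi_indices big_filter big_enum_cond /= [RHS]big_mkcond /=.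
  apply: eq_bigr => j _; case: ifP => // /negbT jdN.
  apply/eqP; apply: contraNT jdN => /prodf_neq0 nz.
  apply: leq_trans jd; apply: leq_sum => s _; have := nz s isT; apply: contraNT.
  by rewrite -ltnNge => lt; rewrite bin_small // mulr0n.
rewrite big_multi_indices; apply: eq_bigr => l _.
by rewrite !mxE -big_split /=; apply: eq_bigr => s _; rewrite mulrnAr.
Qed.

(* A permutation of the multi-indices that never increases any coordinate preserves the
   total degree, hence fixes every multi-index: only the diagonal contributes. *)
Lemma det_translation_mx (b : 'rV[R]_n) : \det (translation_mx b) = 1.
Proof.
rewrite /determinant (bigD1 (1%g : {perm 'I_N.+1})) //= odd_perm1 expr0 mul1r.
rewrite [X in X + _]big1 => [|l _]; last first.
  by rewrite perm1 mxE big1 // => i _; rewrite subnn expr0 binn.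
rewrite big1 ?addr0 // => s s1; apply/eqP; apply: contraNT s1.
rewrite mulf_eq0 signr_eq0 /= => /prodf_neq0 nz.
have le (l : 'I_N.+1) i : (mi l i <= mi (s l) i)%N by apply: (translation_mx_neq0 (b := b)); exact: nz.
have sumE : (\sum_(l < N.+1) \sum_i mi l i = \sum_(l < N.+1) \sum_i mi (s l) i)%N.
  by rewrite [LHS](reindex_inj (@perm_inj _ s)).
have eqd (l : 'I_N.+1) : (\sum_i mi l i = \sum_i mi (s l) i)%N.
  apply/eqP; have [_] : (\sum_(l < N.+1) \sum_i mi l i <=
    \sum_(l < N.+1) \sum_i mi (s l) i
      ?= iff [forall l : 'I_N.+1, \sum_i mi l i == \sum_i mi (s l) i])%N.
    by apply: leqif_sum => k _; apply: leqif_eq; apply: leq_sum => i _.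
  by rewrite sumE eqxx => /esym/forallP.
apply/eqP/permP => l; rewrite perm1; apply/esym/nth_multi_indices_inj => /=.
apply/ffunP => i; apply/val_inj => /=; apply/eqP.
have [_] : (\sum_i mi l i <= \sum_i mi (s l) i
    ?= iff [forall i, mi l i == mi (s l) i :> nat])%N.
  by apply: leqif_sum => k _; apply: leqif_eq.
by rewrite eqd eqxx => /esym/forallP.
Qed.

Lemma vandermonde_scale (A : 'I_N.+1 -> 'rV[R]_n) (r : R) :
  vandermonde d (fun i => r *: A i) =
  vandermonde d A *m diag_mx (\row_l r ^+ (\sum_(i < n) mi l i)%N).
Proof.
apply/matrixP => i l; rewrite mul_mx_diag !mxE /monom -prodrXr -big_split /=.
by apply: eq_bigr => s _; rewrite mxE exprMn mulrC.
Qed.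

(** Translation multiplies by a matrix of determinant 1, scaling by a diagonal matrix with entries
    r^|j|; their product has as exponent the total degree of all multi-indices. *)
Lemma det_vandermonde_affine (A : 'I_N.+1 -> 'rV[R]_n) (b : 'rV[R]_n) (r : R) :
  \det (vandermonde d (fun i => r *: A i + b)) =
  r ^+ (n * Nbin n.+1 (d%:Z - 1)) * \det (vandermonde d A).
Proof.
rewrite vandermonde_translate det_mulmx det_translation_mx mulr1.
rewrite vandermonde_scale det_mulmx det_diag mulrC; congr (_ * _).
rewrite -sum_degree_multi_indices big_multi_indices -prodrXr.
by apply: eq_bigr => l _; rewrite mxE.
Qed.

End Vandermonde.
End MultiIndexEnumeration.

(** * Cramer's rule with explicit bounds *)

Section Cramer.
Context {R : realType} {N : nat}.

Lemma normr_det_le (k : nat) (M : 'M[R]_k) :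
  (forall i j, `|M i j| <= 1) -> `|\det M| <= (k`!)%:R.
Proof.
move=> M1; apply: le_trans (ler_norm_sum _ _ _) _.
rewrite -card_Sn -sum1_card natr_sum; apply: ler_sum => s _.
rewrite normrM normrX normrN1 expr1n mul1r normr_prod.
by apply: prodr_ile1 => i _; rewrite normr_ge0 M1.
Qed.

(** The adjugate expresses det M times [x] through [b]. Each of the N+1 summands carries a cofactor
    of modulus at most N!, which adds up to (N+1)!. Keeping the determinant on the left avoids
    dividing by it. *)
Lemma normr_cramer_le (M : 'M[R]_N.+1) (x b : 'I_N.+1 -> R) (B : R) :
  (forall i j, `|M i j| <= 1) -> (forall i, b i = \sum_l M i l * x l) ->
  (forall i, `|b i| <= B) -> forall l, `|\det M * x l| <= (N.+1`!)%:R * B.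
Proof.
move=> M1 Mxb bB l.
have -> : \det M * x l = \sum_i \adj M l i * b i.
  have := congr1 (fun A : 'M[R]_N.+1 => (A *m \col_k x k) l ord0) (mul_adj_mx M).
  rewrite -mulmxA mul_scalar_mx !mxE => <-; apply: eq_bigr => i _.
  by rewrite !mxE Mxb; congr (_ * _); apply: eq_bigr => k _; rewrite !mxE.
apply: le_trans (ler_norm_sum _ _ _) _.
have -> : (N.+1`!)%:R * B = \sum_(i < N.+1) (N`!)%:R * B.
  by rewrite sumr_const card_ord factS natrM -mulrA mulr_natl.
apply: ler_sum => i _; rewrite normrM ler_pM ?bB // mxE /cofactor.
rewrite normrM normrX normrN1 expr1n mul1r; apply: normr_det_le => u v.
by rewrite !mxE.
Qed.
End Cramer.

(** * Taylor approximation with a remainder uniform in the base point *)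

Section Taylor.
Context {R : realType} {n : nat}.
Implicit Types (G g f : 'rV[R]_n -> R) (a h x : 'rV[R]_n) (s : seq 'I_n).

Lemma iter_partial_cat s1 s2 f :
  iter_partial (s1 ++ s2) f = iter_partial s1 (iter_partial s2 f).
Proof. by elim: s1 => //= i s1 ->. Qed.

Lemma Cd_on_iter_partial D U f s : (size s <= D)%N ->
  Cd_on D U f -> Cd_on (D - size s) U (iter_partial s f).
Proof.
move=> sD [df cf]; split=> [s' i x s'D Ux|s' x s'D Ux]; rewrite -iter_partial_cat.
  by apply: df => //; rewrite size_cat; lia.
by apply: cf => //; rewrite size_cat; lia.
Qed.

Lemma is_derive_line G x (v : 'rV[R]_n) (t : R) : derivable G (x + t *: v) v ->
  is_derive t (1 : R) (fun u : R => G (x + u *: v)) ('D_v G (x + t *: v)).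
Proof.
have E : (fun u : R => u^-1 *: (((fun u : R => G (x + u *: v)) \o shift t) (u *: 1) -
    G (x + t *: v))) =
  (fun u : R => u^-1 *: ((G \o shift (x + t *: v)) (u *: v) - G (x + t *: v))).
  apply/funext => u /=; congr (_ *: (G _ - _)).
  by rewrite [u *: 1]mulr1 scalerDl addrCA addrC -!addrA.
move=> dG; split; first by rewrite /derivable E.
by rewrite /derive E.
Qed.

Lemma mean_value0 (phi dphi : R -> R) (t : R) :
  (forall u : R, `|u| <= `|t| -> is_derive u (1 : R) phi (dphi u)) ->
  exists2 u, `|u| <= `|t| & phi t - phi 0 = dphi u * t.
Proof.
move=> dphiP.
have cont (b c : R) : `|b| <= `|t| -> `|c| <= `|t| ->
    {within `[b, c], continuous phi}.
  move=> bt ct; apply: derivable_within_continuous => u. rewrite in_itv /= => uI.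
  suff /dphiP[] : `|u| <= `|t| by [].
  move: bt ct uI.
  rewrite !ler_norml => /andP[? ?] /andP[? ?] /andP[? ?]; apply/andP; split; lra.
have [t0|t0] := leP 0 t.
  have [u|u|u uI phiE] := @MVT_segment R phi dphi _ _ t0.
  - by rewrite in_itv /= => /andP[u0 ut]; apply: dphiP; rewrite (ger0_norm t0) ger0_norm ltW.
  - by apply: cont; rewrite // normr0.
  - exists u; last by rewrite phiE subr0.
    by move: uI; rewrite in_itv /= => /andP[u0 ut]; rewrite !ger0_norm.
have [u|u|u uI phiE] := @MVT_segment R phi dphi _ _ (ltW t0).
- by rewrite in_itv /= => /andP[u0 ut]; apply: dphiP; rewrite !ltr0_norm ?lerN2 ?ltW.
- by apply: cont; rewrite // normr0.
- exists u; last by rewrite -opprB phiE sub0r mulrN opprK.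
  move: uI; rewrite in_itv /= => /andP[u0 ut].
  by rewrite (ltr0_norm t0) ler0_norm // lerN2.
Qed.

Lemma partial_iter_partial (k : nat) (i : 'I_n) G :
  iter_partial (nseq k i) (partial i G) = iter_partial (nseq k.+1 i) G.
Proof. by elim: k => //= k ->. Qed.

(** Induction on [D]: [G] minus its Taylor polynomial vanishes at parameter 0, and its derivative is
    the remainder for [partial i G] of one order less, so the mean value theorem contributes one
    more factor |t|. *)
Lemma taylor_line (i : 'I_n) (eps : R) D G x (t : R) :
  (forall k u, (k < D)%N -> `|u| <= `|t| ->
    derivable (iter_partial (nseq k i) G) (x + u *: delta_mx ord0 i) (delta_mx ord0 i)) ->
  (forall u, `|u| <= `|t| ->
    `|iter_partial (nseq D i) G (x + u *: delta_mx ord0 i) -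
      iter_partial (nseq D i) G x| <= eps) ->
  `|G (x + t *: delta_mx ord0 i) -
    \sum_(k < D.+1) iter_partial (nseq k i) G x / k`!%:R * t ^+ k| <= eps * `|t| ^+ D.
Proof.
elim: D G t => [|D IH] G t dG cG.
  by rewrite big_ord1 /= fact0 divr1 !expr0 !mulr1 cG.
pose c k := iter_partial (nseq k i) G x.
pose P := \poly_(k < D.+2) (c k / k`!%:R).
have dPE : P^`() = \poly_(k < D.+1) (c k.+1 / k`!%:R).
  apply/polyP => k; rewrite coef_deriv !coef_poly ltnS; case: ifP => _; last by rewrite mul0rn.
  rewrite -[LHS]mulr_natr factS natrM invfM -!mulrA; congr (_ * _).
  by rewrite mulrCA mulVf ?mulr1 ?pnatr_eq0.
pose phi u := G (x + u *: delta_mx ord0 i) - P.[u].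
pose dphi u := partial i G (x + u *: delta_mx ord0 i) - P^`().[u].
have dphiP (u : R) : `|u| <= `|t| -> is_derive u (1 : R) phi (dphi u).
  by move=> ut; apply: is_deriveB; apply: is_derive_line; exact: (dG 0%N).
have dphi_le u : `|u| <= `|t| -> `|dphi u| <= eps * `|u| ^+ D.
  move=> ut; rewrite /dphi dPE horner_poly.
  have -> : \sum_(k < D.+1) c k.+1 / k`!%:R * u ^+ k =
      \sum_(k < D.+1) iter_partial (nseq k i) (partial i G) x / k`!%:R * u ^+ k.
    by apply: eq_bigr => k _; rewrite partial_iter_partial.
  apply: IH => [k v kD vu|v vu]; rewrite partial_iter_partial.
    by apply: dG; rewrite // (le_trans vu).
  by apply: cG; rewrite (le_trans vu).
have [u ut] := mean_value0 dphiP.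
have -> : phi 0 = 0.
  rewrite /phi scale0r addr0 horner_poly big_ord_recl big1 ?addr0 => [|k _].
    by rewrite expr0 mulr1 /c /= fact0 divr1 subrr.
  by rewrite expr0n mulr0.
rewrite subr0 /phi horner_poly => ->; rewrite normrM exprSr mulrA ler_wpM2r //.
apply: le_trans (dphi_le u ut) _.
apply: ler_wpM2l; last by rewrite lerXn2r ?nnegrE.
(* [cG] at parameter 0 shows that [eps] is nonnegative. *)
by apply: le_trans (normr_ge0 _) (cG 0 _); rewrite normr0.
Qed.

(* One variable is expanded at a time, starting with the head of [s]. The derivatives in
   the later variables of [s] come outermost, so [s = rev (enum 'I_n)] reproduces the order
   of differentiation in [partial_mi] and symmetry of mixed derivatives is never needed. *)
Fixpoint taylor_sum s D g a h : R :=
  if s is i :: s' then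
    \sum_(k < D.+1)
      taylor_sum s' (D - k)%N (iter_partial (nseq k i) g) a h / k`!%:R * h ord0 i ^+ k
  else g a.

Lemma eq_taylor_sum s D g a h h' : (forall i, i \in s -> h ord0 i = h' ord0 i) ->
  taylor_sum s D g a h = taylor_sum s D g a h'.
Proof.
elim: s D g => //= i s IH D g hh; apply: eq_bigr => k _.
rewrite (IH _ _) => [|l ls]; first by rewrite hh // mem_head.
by apply: hh; rewrite in_cons ls orbT.
Qed.

Lemma nbhs0_box (P : set 'rV[R]_n) : nbhs (0 : 'rV[R]_n) P ->
  exists2 del, 0 < del & forall x, (forall i, `|x ord0 i| < del) -> P x.
Proof.
move=> /nbhs_ballP[del /= del0 delP]; exists del => // x xdel; apply: delP.
split=> // i j; rewrite ord1 mxE /ball /= sub0r normrN; exact: xdel.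
Qed.

Lemma uniform_radius (P : nat -> R -> Prop) D :
  (forall k del del', del' <= del -> P k del -> P k del') ->
  (forall k, (k <= D)%N -> exists2 del, 0 < del & P k del) ->
  exists2 del, 0 < del & forall k, (k <= D)%N -> P k del.
Proof.
move=> Pmono; elim: D => [|D IH] PD.
  have [del del0 Pdel] := PD 0%N (leqnn _).
  by exists del => // k; rewrite leqn0 => /eqP->.
have [k kD|d1 d10 Pd1] := IH; first by apply: PD; rewrite leqW.
have [d2 d20 Pd2] := PD D.+1 (leqnn _).
exists (Num.min d1 d2) => [|k]; first by rewrite lt_min d10.
rewrite leq_eqVlt => /predU1P[->|kD]; first by apply: Pmono Pd2; rewrite ge_min lexx orbT.
by apply: (Pmono k d1); [rewrite ge_min lexx|exact: Pd1].
Qed.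

(** Induction on [s]: expand along [i] from [a + h'], where [h'] is [h] with coordinate [i] erased,
    then expand each derivative of order [k] from [a] to order [D - k] in the remaining variables.
    Uniformity in [a] matters because the base points will move along a sequence. *)
Lemma taylor_sum_approx s D g (U : set 'rV[R]_n) : uniq s -> open U -> U 0 -> Cd_on D U g ->
  forall eps, 0 < eps -> exists2 del, 0 < del & forall a h (rho : R),
    0 <= rho < del -> (forall i, `|a ord0 i| < del) ->
    (forall i, `|h ord0 i| <= rho) -> (forall i, i \notin s -> h ord0 i = 0) ->
    `|g (a + h) - taylor_sum s D g a h| <= eps * rho ^+ D.
Proof.
move=> us oU U0; elim: s us D g => [_|i s IH /= /andP[iNs us]] D g gD eps eps0.
  exists 1 => // a h rho /andP[rho0 _] _ _ h0.
  have -> : h = 0 by apply/rowP => i; rewrite h0 // mxE.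
  by rewrite addr0 subrr normr0 mulr_ge0 ?exprn_ge0 // ltW.
(* Half of [eps] pays for the expansion along [i]; the other half is shared by the [D.+1] terms of
   the sum. *)
pose eps' := eps / 2 / D.+1%:R.
have eps'0 : 0 < eps' by rewrite !divr_gt0.
pose approx k del := forall a h (rho : R),
    0 <= rho < del -> (forall i, `|a ord0 i| < del) ->
    (forall i, `|h ord0 i| <= rho) -> (forall i, i \notin s -> h ord0 i = 0) ->
    `|iter_partial (nseq k i) g (a + h) -
      taylor_sum s (D - k)%N (iter_partial (nseq k i) g) a h| <= eps' * rho ^+ (D - k).
have [|k kD|d1 d10 Pd1] := uniform_radius (P := approx) (D := D).
- move=> k d d' dd' Pd a h rho /andP[rho0 rhod] ad hrho hs.
  apply: Pd => // [|l]; first by rewrite rho0 (lt_le_trans rhod).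
  exact: lt_le_trans (ad l) dd'.
- apply: (IH us (D - k)%N) => //.
  by rewrite -[X in (D - X)%N](size_nseq k i); apply: Cd_on_iter_partial; rewrite ?size_nseq.
have [d2 d20 Ud2] := nbhs0_box (open_nbhs_nbhs (conj oU U0)).
(* Two values within eps / 4 of the value at 0 differ by at most eps / 2, the oscillation fed to
   [taylor_line]. *)
have [d3 d30 cd3] : exists2 d3, 0 < d3 & forall x, (forall i, `|x ord0 i| < d3) ->
    `|iter_partial (nseq D i) g 0 - iter_partial (nseq D i) g x| < eps / 4.
  apply: nbhs0_box; have := gD.2 (nseq D i) 0; rewrite size_nseq => /(_ (leqnn _) U0).
  by move=> /cvgrPdist_lt/(_ (eps / 4)); apply; rewrite divr_gt0.
(* The halving leaves room for sums: coordinates of [a] and of the increment are each below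
   [del]. *)
pose del := Num.min d1 (Num.min d2 d3) / 2.
have mpos : 0 < Num.min d1 (Num.min d2 d3) by rewrite !lt_min d10 d20 d30.
have del0 : 0 < del by rewrite divr_gt0.
exists del => // a h rho /andP[rho0 rhodel] adel hrho hs.
have [dd1 dd2 dd3] : [/\ del * 2 <= d1, del * 2 <= d2 & del * 2 <= d3].
  by rewrite /del divfK ?pnatr_eq0 // !ge_min !lexx !orbT.
pose h' : 'rV[R]_n := \row_l if l == i then 0 else h ord0 l.
have hE : a + h = a + h' + h ord0 i *: delta_mx ord0 i.
  apply/rowP => l; rewrite !mxE eqxx /=; case: (l =P i) => [->|_].
    by rewrite addr0 mulr1.
  by rewrite mulr0 addr0.
have box u : `|u| <= `|h ord0 i| -> forall l,
    `|(a + h' + u *: delta_mx ord0 i) ord0 l| < del * 2.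
  move=> uh l; rewrite mulr_natr mulr2n -addrA mxE; apply: le_lt_trans (ler_normD _ _) _.
  apply: ltrD; rewrite ?adel // !mxE eqxx /=; apply: le_lt_trans rhodel.
  case: (l =P i) => [_|_]; last by rewrite mulr0 addr0.
  by rewrite add0r mulr1 (le_trans uh).
have boxx l : `|(a + h') ord0 l| < del * 2.
  by have := box 0; rewrite normr0 scale0r addr0; apply.
have line : `|g (a + h) -
    \sum_(k < D.+1) iter_partial (nseq k i) g (a + h') / k`!%:R * h ord0 i ^+ k|
      <= eps / 2 * rho ^+ D.
  rewrite hE; apply: le_trans (_ : eps / 2 * `|h ord0 i| ^+ D <= _); last first.
    by rewrite ler_wpM2l ?divr_ge0 ?(ltW eps0) // lerXn2r ?nnegrE.
  apply: taylor_line => [k u kD uh|u uh].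
    apply: gD.1; rewrite ?size_nseq //; apply: Ud2 => l.
    by apply: lt_le_trans (box u uh l) _.
  have b1 := cd3 _ (fun l => lt_le_trans (box u uh l) dd3).
  have b2 := cd3 _ (fun l => lt_le_trans (boxx l) dd3).
  apply: le_trans (ler_distD (iter_partial (nseq D i) g 0) _ _) _.
  by rewrite [X in X + _]distrC; lra.
have sums : `|\sum_(k < D.+1) iter_partial (nseq k i) g (a + h') / k`!%:R * h ord0 i ^+ k -
    taylor_sum (i :: s) D g a h| <= eps / 2 * rho ^+ D.
  rewrite /= -sumrB; apply: le_trans (ler_norm_sum _ _ _) _.
  have -> : eps / 2 * rho ^+ D = \sum_(k < D.+1) eps' * rho ^+ D.
    by rewrite sumr_const card_ord -[RHS]mulr_natr [RHS]mulrAC /eps' divfK ?pnatr_eq0.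
  apply: ler_sum => k _; have kD : (k <= D)%N by rewrite -ltnS.
  rewrite -mulrBl -mulrBl !normrM normrX.
  rewrite (@eq_taylor_sum s _ _ a h h'); last first.
    move=> l ls; rewrite mxE; case: eqP => // li; by rewrite -li ls in iNs.
  (* The error rho^(D - k) and the factor |h_i|^k combine to rho^D; dividing by k! only shrinks the
     term. *)
  rewrite -[X in rho ^+ X](subnK kD) exprD mulrA ler_pM ?mulr_ge0 //; last first.
    by rewrite lerXn2r ?nnegrE.
  rewrite -[leRHS]mulr1 ler_pM //.
    apply: (Pd1 k kD a h' rho) => // [||l|l ls].
    - rewrite rho0 (lt_le_trans rhodel) // (le_trans _ dd1) //; lra.
    - by move=> l; apply: lt_le_trans (adel l) _; rewrite (le_trans _ dd1) //; lra.
    - by rewrite mxE; case: eqP => // _; rewrite normr0.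
    - rewrite mxE; case: eqP => // /eqP li.
      by apply: hs; rewrite in_cons negb_or li.
  by rewrite normfV normr_nat invf_le1 ?ltr0n ?fact_gt0 // ler1n fact_gt0.
apply: le_trans (ler_distD _ _ _) (le_trans (lerD line sums) _).
by rewrite -mulrDl -splitr.
Qed.
End Taylor.

(** * The nested Taylor sum as a sum over multi-indices *)

Section TaylorExpansion.
Context {R : realType} {n d : nat}.
Implicit Types (g f : 'rV[R]_n -> R) (a h : 'rV[R]_n) (s : seq 'I_n)
  (j : {ffun 'I_n -> 'I_d.+1}).

Definition set_coord (i : 'I_n) (k : 'I_d.+1) j : {ffun 'I_n -> 'I_d.+1} :=
  [ffun l => if l == i then k else j l].

Lemma sum_set_coord0 i j :
  (\sum_(l < n) j l = j i + \sum_(l < n) set_coord i ord0 j l)%N.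
Proof.
rewrite (bigD1 i) //= [in RHS](bigD1 i) //= ffunE eqxx add0n; congr (_ + _)%N.
by apply: eq_bigr => l /negbTE li; rewrite ffunE li.
Qed.

Definition supported s j := [forall l, (l \notin s) ==> (j l == ord0)].

Lemma supported_cons i s j : i \notin s ->
  supported (i :: s) j = supported s (set_coord i ord0 j).
Proof.
move=> iNs; apply/forallP/forallP => sj l; apply/implyP => ls; last first.
  move: ls; rewrite in_cons negb_or => /andP[/negbTE li ls].
  by have /implyP/(_ ls) := sj l; rewrite ffunE li.
rewrite ffunE; case: (l =P i) => // /eqP li.
by have /implyP-> := sj l; rewrite ?in_cons ?negb_or ?li.
Qed.

(** Induction on [s]: the order [k] in the head variable and a multi-index supported on the tail
    merge into one multi-index. Conversely [j] splits into its entry at [i] and [j] with that entry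
    zeroed. *)
Lemma taylor_sum_multi_index s D g a h : uniq s -> (D <= d)%N ->
  taylor_sum s D g a h =
  \sum_(j | supported s j && (\sum_(i < n) j i <= D)%N)
    iter_partial (flatten [seq nseq (j i) i | i <- rev s]) g a *
    \prod_(i < n) (h ord0 i ^+ j i / (j i)`!%:R).
Proof.
elim: s D g => [|i s IH] /= D g => [_ Dd|/andP[iNs us] Dd].
  rewrite (big_pred1 [ffun=> ord0]) => [/=|j].
    by rewrite big1 ?mulr1 // => i _; rewrite ffunE expr0 fact0 divr1.
  apply/andP/eqP => [[/forallP j0 _]|->].
    by apply/ffunP => l; rewrite ffunE; apply/eqP; have := j0 l.
  split; first by apply/forallP => l; rewrite ffunE eqxx implybT.
  by rewrite big1 // => l _; rewrite ffunE.
rewrite (big_ord_widen d.+1 (fun k => taylor_sum s (D - k)%N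
  (iter_partial (nseq k i) g) a h / k`!%:R * h ord0 i ^+ k)) ?ltnS //.
transitivity (\sum_(k < d.+1 | (k < D.+1)%N)
    \sum_(j | supported s j && (\sum_(i < n) j i <= D - k)%N)
    (iter_partial (flatten [seq nseq (j i) i | i <- rev s]) (iter_partial (nseq k i) g) a *
    \prod_(i < n) (h ord0 i ^+ j i / (j i)`!%:R)) / k`!%:R * h ord0 i ^+ k).
  apply: eq_bigr => k _; rewrite IH // ?(leq_trans (leq_subr _ _)) //.
  by rewrite !mulr_suml.
rewrite pair_big_dep /=.
rewrite (reindex_onto (fun j => (j i, set_coord i ord0 j))
  (fun p => set_coord i p.1 p.2)) /=; last first.
  case=> k j /= /andP[_ /andP[/forallP sj _]]; congr pair; first by rewrite ffunE eqxx.
  apply/ffunP => l; rewrite !ffunE; case: eqP => // ->.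
  by have := sj i; rewrite iNs => /eqP.
apply: eq_big => [j|j _].
  rewrite supported_cons // [in RHS](sum_set_coord0 i).
  have -> : set_coord i (j i) (set_coord i ord0 j) == j.
    by apply/eqP/ffunP => l; rewrite !ffunE; case: eqP => // ->.
  rewrite andbT andbCA; congr (_ && _).
  by move: (\sum_(_ < n) _)%N => t; lia.
rewrite -iter_partial_cat rev_cons map_rcons flatten_rcons -!mulrA.
have -> : [seq nseq (set_coord i ord0 j l) l | l <- rev s] =
    [seq nseq (j l) l | l <- rev s].
  apply/eq_in_map => l; rewrite mem_rev ffunE; case: eqP => // -> is_.
  by rewrite is_ in iNs.
congr (_ * _); rewrite (bigD1 i) //= [in RHS](bigD1 i) //= ffunE eqxx.
rewrite expr0 fact0 divr1 mul1r [in RHS]mulrC; congr (_ * _); last by rewrite mulrC.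
by apply: eq_bigr => l /negbTE li; rewrite ffunE li.
Qed.

Lemma taylor_sum_rev_enum f a h :
  taylor_sum (rev (enum 'I_n)) d f a h =
  \sum_(j <- multi_indices n d)
    partial_mi (fun i => j i) f a / (\prod_(i < n) (j i)`!)%:R * monom h (fun i => j i).
Proof.
rewrite taylor_sum_multi_index ?rev_uniq ?enum_uniq // revK.
rewrite /multi_indices big_filter big_enum_cond /=; apply: eq_big => [j|j _].
  rewrite (_ : supported _ j); first by [].
  by apply/forallP => l; rewrite mem_rev mem_enum.
rewrite -mulrA; congr (_ * _).
by rewrite big_split /= mulrC natr_prod -prodfV.
Qed.

Lemma taylor_approx f (U : set 'rV[R]_n) : open U -> U 0 -> Cd_on d U f ->
  forall eps, 0 < eps -> exists2 del, 0 < del & forall a h (rho : R),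
    0 <= rho < del -> (forall i, `|a ord0 i| < del) -> (forall i, `|h ord0 i| <= rho) ->
    `|f (a + h) - \sum_(j <- multi_indices n d)
      partial_mi (fun i => j i) f a / (\prod_(i < n) (j i)`!)%:R * monom h (fun i => j i)|
    <= eps * rho ^+ d.
Proof.
move=> oU U0 fd eps eps0.
have us : uniq (rev (enum 'I_n)) by rewrite rev_uniq enum_uniq.
have [del del0 approx] := taylor_sum_approx us oU U0 fd eps0.
exists del => // a h rho rhod ad hrho; rewrite -taylor_sum_rev_enum.
by apply: approx => // i; rewrite mem_rev mem_enum.
Qed.

End TaylorExpansion.

(** * Determinant and coefficient bounds for a configuration rescaled to unit size *)

Section Configuration.
Context {R : realType} {n d N : nat}.
Hypothesis hN : N.+1 = 'C(n + d, d).
Local Notation mi l := (nth [ffun=> ord0] (multi_indices n d) l).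
Local Notation E := (n * Nbin n.+1 (d%:Z - 1))%N.

Lemma coord_le_enorm (x : 'rV[R]_n) (i : 'I_n) : `|x ord0 i| <= enorm x.
Proof.
rewrite -sqrtr_sqr ler_sqrt; last by apply: sumr_ge0 => l _; exact: sqr_ge0.
by rewrite (bigD1 i) //= lerDl; apply: sumr_ge0 => l _; exact: sqr_ge0.
Qed.

Variables (A : 'I_N.+1 -> 'rV[R]_n) (b : 'rV[R]_n) (r : R).
Hypothesis r0 : 0 < r.
Hypothesis Ab : forall i l, `|(A i - b) ord0 l| <= r.
Let Y i := r^-1 *: (A i - b).

Let det_rescaled : \det (vandermonde d A) = r ^+ E * \det (vandermonde d Y).
Proof.
rewrite -(det_vandermonde_affine hN _ b); congr (\det (vandermonde d _)).
by apply/funext => i; rewrite scalerA mulfV ?gt_eqF // scale1r subrK.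
Qed.

Let vandermonde_rescaled_le1 i l : `|vandermonde d Y i l| <= 1.
Proof.
rewrite mxE /monom normr_prod; apply: prodr_ile1 => k _.
rewrite normr_ge0 normrX exprn_ile1 // mxE normrM normfV (gtr0_norm r0).
by rewrite mulrC ler_pdivrMr // mul1r Ab.
Qed.

Lemma normr_det_vandermonde_le : `|\det (vandermonde d A)| <= (N.+1`!)%:R * r ^+ E.
Proof.
rewrite det_rescaled normrM normrX (gtr0_norm r0) mulrC ler_wpM2r ?exprn_ge0 ?(ltW r0) //.
exact: normr_det_le.
Qed.

(** In the rescaled variable the coefficient of index [j] becomes r^|j| times [coef j], and the
    matrix entries have modulus at most 1, so the Cramer bound applies. The factor r^E turns Det
    V(Y) back into Det V(A). *)
Lemma normr_coef_le (coef : {ffun 'I_n -> 'I_d.+1} -> R) (B : R) :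
  (forall i, `|\sum_(j <- multi_indices n d)
     coef j * monom (A i - b) (fun l => j l)| <= B) ->
  forall j : {ffun 'I_n -> 'I_d.+1}, (\sum_(i < n) j i <= d)%N ->
  `|\det (vandermonde d A)| * (r ^+ (\sum_(i < n) j i)%N * `|coef j|) <=
  (N.+1`!)%:R * B * r ^+ E.
Proof.
move=> coefB j /(nth_multi_indices_surj hN)[l <-].
have := normr_cramer_le (x := fun l => r ^+ (\sum_(i < n) mi l i)%N * coef (mi l))
  vandermonde_rescaled_le1 (fun i => erefl) _ l => /(_ B) bound.
rewrite det_rescaled normrM normrX (gtr0_norm r0) -[leLHS]mulrA [leLHS]mulrC.
rewrite ler_wpM2r ?exprn_ge0 ?(ltW r0) //.
rewrite -[r ^+ (\sum__ _)%N]ger0_norm ?exprn_ge0 ?(ltW r0) // -!normrM; apply: bound => i.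
move: (coefB i); rewrite (big_multi_indices hN); congr (`|_| <= _).
apply: eq_bigr => k _; rewrite mxE mulrA [in RHS]mulrC; congr (_ * _).
rewrite /monom -prodrXr -big_split /=; apply: eq_bigr => s _.
by rewrite [in RHS]mxE -exprMn mulrAC mulVf ?gt_eqF // mul1r.
Qed.

End Configuration.

(** * Passage to the limit and flatness at the origin *)

Lemma cvg_powR0 (R : realType) (r : nat -> R) (x : R) : (forall k, 0 < r k) ->
  r @ \oo --> 0 -> 0 < x -> r k `^ x @[k --> \oo] --> 0.
Proof.
move=> r0 rc x0; apply: cvg_comp (powR_cvg0 x0) => P.
rewrite /at_right /within /= => nP; have := rc _ nP; rewrite /nbhs /=.
by apply: filterS => k /(_ (r0 k)).
Qed.

Lemma partial_mi_continuous (R : realType) (n d : nat) (U : set 'rV[R]_n)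
    (f : 'rV[R]_n -> R) (q : 'I_n -> nat) (x : 'rV[R]_n) :
  Cd_on d U f -> (\sum_(i < n) q i <= d)%N -> U x ->
  {for x, continuous (partial_mi q f)}.
Proof.
move=> [_ cf] qd; apply: cf; rewrite size_flatten /shape -map_comp.
rewrite sumnE big_map big_enum /= (eq_bigr q) // => i _.
by rewrite size_nseq.
Qed.

Section Flatness.
Context {R : realType} {n d N : nat}.
Hypothesis hN : N.+1 = 'C(n + d, d).
Variables (p : R) (r : nat -> R) (a : nat -> 'I_N.+1 -> 'rV[R]_n) (c e : R).
Hypothesis hpd : p <= d%:R.
Hypothesis hr : forall k, 0 < r k.
Hypothesis hball : forall k (i : 'I_N.+1), enorm (a k i - a k ord0) <= r k.
Hypothesis hr0 : r @ \oo --> 0.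
Hypothesis ha0 : (fun k => a k ord0) @ \oo --> (0 : 'rV[R]_n).
Hypothesis hc : 0 < c.
Hypothesis hdet : forall k, `|\det (vandermonde d (a k))| >= c * (r k) `^ e.
Local Notation E := (n * Nbin n.+1 (d%:Z - 1))%N.

Let coord_le k i l : `|(a k i - a k ord0) ord0 l| <= r k.
Proof. exact: le_trans (coord_le_enorm _ _) (hball k i). Qed.

(** If e < E, the lower and upper determinant bounds give c <= (N+1)! r_k^(E - e), whose right side
    tends to 0. *)
Lemma det_exponent_ge : E%:R <= e.
Proof.
rewrite leNgt; apply/negP => eE.
have x0 : 0 < E%:R - e by rewrite subr_gt0.
have K0 : 0 < (N.+1`!)%:R :> R by rewrite ltr0n fact_gt0.
have /cvgrPdist_lt/(_ (c / (N.+1`!)%:R)) := cvg_powR0 hr hr0 x0.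
rewrite divr_gt0 // => /(_ isT)[k _ /(_ k (leqnn k))] /=.
rewrite sub0r normrN ger0_norm ?powR_ge0 // ltr_pdivlMr // ltNge => /negP; apply.
have := le_trans (hdet k) (normr_det_vandermonde_le hN (hr k) (coord_le k)).
rewrite powRB ?gt_eqF ?implybT // powR_mulrn ?(ltW (hr k)) //.
by rewrite mulrAC ler_pdivlMr ?powR_gt0 // [leRHS]mulrC.
Qed.

Variables (U : set 'rV[R]_n) (f : 'rV[R]_n -> R).
Hypothesis hU : open U.
Hypothesis hU0 : U 0.
Hypothesis hf : Cd_on d U f.
(** The default 0 of the maximum is harmless, since absolute values are nonnegative. *)
Let S k := (r k) `^ (- p) * \big[Num.max/0]_(i < N.+1) `|f (a k i)|.
Let m := p - (e - E%:R).

(** Combines the coefficient bound with the lower bound c r_k^e on the determinant. [C] collects q!,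
    (N+1)! and 1/c, hence does not depend on [eps], which absorbs the Taylor remainder. *)
Lemma partial_mi_bound (q : 'I_n -> nat) : (\sum_(i < n) q i <= d)%N ->
  exists2 C, 0 < C & forall eps, 0 < eps -> \forall k \near \oo,
    `|partial_mi q f (a k ord0)| <=
      C * (S k + eps) * r k `^ (m - (\sum_(i < n) q i)%:R).
Proof.
move=> qd.
have qlt i : (q i < d.+1)%N by rewrite ltnS (leq_trans _ qd) // (bigD1 i) //= leq_addr.
pose j : {ffun 'I_n -> 'I_d.+1} := [ffun i => inord (q i)].
have qE : q = (fun i => j i : nat) by apply/funext => i; rewrite ffunE inordK.
have K0 : 0 < (N.+1`!)%:R :> R by rewrite ltr0n fact_gt0.
have F0 : 0 < (\prod_(i < n) (j i)`!)%:R :> R.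
  by rewrite ltr0n prodn_gt0 // => i; rewrite fact_gt0.
exists ((\prod_(i < n) (j i)`!)%:R * (N.+1`!)%:R / c) => [|eps eps0].
  by rewrite divr_gt0 ?mulr_gt0.
have [del del0 approx] := taylor_approx hU hU0 hf eps0.
have r_small (eta : R) : 0 < eta -> \forall k \near \oo, r k < eta.
  move=> eta0; have /cvgrPdist_lt/(_ _ eta0) := hr0; apply: filterS => k.
  by rewrite sub0r normrN gtr0_norm.
have a_small : \forall k \near \oo, forall i, `|a k ord0 ord0 i| < del.
  have /cvgrPdist_lt/(_ _ del0) := ha0; apply: filterS => k.
  rewrite sub0r normrN => ak i; apply: le_lt_trans ak.
  by rewrite [leRHS]/Num.norm /= mx_normrE; apply: (le_bigmax _ _ (ord0, i)).
near=> k.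
have rk0 := hr k; have rk1 : r k <= 1 by apply/ltW; near: k; exact: r_small.
have rkdel : 0 <= r k < del by rewrite ltW //=; near: k; exact: r_small.
have akdel : forall i, `|a k ord0 ord0 i| < del by near: k.
have fE i : `|f (a k i)| <= S k * r k `^ p.
  rewrite /S powRN mulrAC mulVf ?mul1r ?gt_eqF ?powR_gt0 //.
  exact: (le_bigmax _ (fun i => `|f (a k i)|)).
(* Since p <= d and r_k <= 1, the remainder eps r_k^d is absorbed into eps r_k^p. *)
have rdp : r k ^+ d <= r k `^ p.
  by rewrite -powR_mulrn ?(ltW rk0) // ger_powR ?rk0.
have bound i : `|\sum_(j <- multi_indices n d)
    partial_mi (fun l => j l) f (a k ord0) / (\prod_(l < n) (j l)`!)%:R *
      monom (a k i - a k ord0) (fun l => j l)| <= (S k + eps) * r k `^ p.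
  have := approx (a k ord0) (a k i - a k ord0) (r k) rkdel akdel (coord_le k i).
  rewrite [a k ord0 + _]addrC subrK => near_f; rewrite mulrDl.
  rewrite -[X in `|X|](subKr (f (a k i))); apply: le_trans (ler_normB _ _) _.
  apply: lerD (fE i) _; apply: le_trans near_f _.
  by rewrite ler_wpM2l // ltW.
rewrite qE in qd *; have := normr_coef_le hN rk0 (coord_le k) bound qd.
set Q := (\sum_(i < n) j i)%N; set g := partial_mi _ _ _; set K := (N.+1`!)%:R in K0 *.
set F := (\prod_(i < n) _)%:R in F0 *.
rewrite normrM normfV (gtr0_norm F0) => le1.
have le2 : c * r k `^ e * (r k ^+ Q * (`|g| / F)) <= K * ((S k + eps) * r k `^ p) * r k ^+ E.
  apply: le_trans le1; rewrite ler_wpM2r //.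
  by rewrite mulr_ge0 ?exprn_ge0 ?(ltW rk0) // divr_ge0 // ltW.
(* The exponent m - |q| is p + E - e - |q|. *)
have -> : r k `^ (m - Q%:R) = r k `^ p * r k ^+ E / (r k `^ e * r k ^+ Q).
  rewrite -!powR_mulrn ?(ltW rk0) // -!powRD ?(gt_eqF rk0) ?implybT //.
  by rewrite -powRB ?(gt_eqF rk0) ?implybT //; congr (_ `^ _); rewrite /m; ring.
rewrite mulrA ler_pdivlMr ?mulr_gt0 ?powR_gt0 ?exprn_gt0 //.
rewrite -(ler_pM2l hc) -(ler_pM2l (_ : 0 < F^-1)) ?invr_gt0 //.
suff -> : F^-1 * (c * (F * K / c * (S k + eps) * (r k `^ p * r k ^+ E))) =
    K * ((S k + eps) * r k `^ p) * r k ^+ E.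
  by apply: le_trans le2; rewrite le_eqVlt; apply/predU1l; ring.
by field; rewrite !gt_eqF.
Unshelve. all: by end_near.
Qed.

(** The base points tend to 0, so continuity of the derivative and uniqueness of limits determine
    its value there. The order stays within [d] because |q| <= m <= p <= d, where m <= p comes from
    [det_exponent_ge]. *)
Lemma flat_of_partial_mi_cvg0 :
  (forall q : 'I_n -> nat, (\sum_(i < n) q i <= d)%N ->
     (\sum_(i < n) q i)%:Z <= Num.floor m -> partial_mi q f (a k ord0) @[k --> \oo] --> 0) ->
  flat_at0 (Num.floor m) f.
Proof.
move=> cvg0 q qm.
have qd : (\sum_(i < n) q i <= d)%N.
  rewrite -(ler_nat R); apply: le_trans hpd.
  have : (\sum_(i < n) q i)%:R <= m by rewrite floor_ge_int in qm.
  by move/le_trans; apply; rewrite gerBl subr_ge0 det_exponent_ge.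
apply: cvg_unique (cvg0 q qd qm) => //.
apply: (@cvg_comp _ _ _ (fun k => a k ord0) (partial_mi q f)); first exact: ha0.
exact: partial_mi_continuous hf qd hU0.
Qed.

End Flatness.

Theorem theorem6p2 (R : realType) (n d N : nat) (hn : (1 <= n)%N)
  (hN : N.+1 = 'C(n + d, d))
  (p : R) (hp0 : 0 < p) (hpd : p <= d%:R)
  (r : nat -> R) (hr : forall k, 0 < r k)
  (a : nat -> 'I_N.+1 -> 'rV[R]_n) (hdist : forall k, injective (a k))
  (hball : forall k (i : 'I_N.+1), enorm (a k i - a k ord0) <= r k)
  (hr0 : r @ \oo --> 0)
  (ha0 : (fun k => a k ord0) @ \oo --> (0 : 'rV[R]_n))
  (c e : R) (hc : 0 < c) (he : 0 < e)
  (hdet : forall k, `|\det (vandermonde d (a k))| >= c * (r k) `^ e)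
  (U : set 'rV[R]_n) (hU : open U) (hU0 : U 0)
  (f : 'rV[R]_n -> R) (hf : Cd_on d U f) :
  let S := fun k => (r k) `^ (- p) * \big[Num.max/0]_(i < N.+1) `|f (a k i)| in
  let m := p - (e - n%:R * (Nbin n.+1 (d%:Z - 1))%:R) in
  ((m \is a Num.int) -> S @ \oo --> 0 -> flat_at0 (Num.floor m) f) /\
  ((m \isn't a Num.int) -> (exists M : R, forall k, `|S k| <= M) ->
      flat_at0 (Num.floor m) f).
Proof.
rewrite -natrM; move=> S m.
have le_m (q : 'I_n -> nat) :
    (\sum_(i < n) q i)%:Z <= Num.floor m -> (\sum_(i < n) q i)%:R <= m.
  by rewrite floor_ge_int.
have bound q := partial_mi_bound hN hpd hr hball hr0 ha0 hc hdet hU hU0 hf (q := q).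
split=> [_ S0|mNint [M SM]]; apply: (flat_of_partial_mi_cvg0 hN hpd hr hball hr0 ha0 hc
  hdet hU0 hf) => q qd /le_m qm; have [C C0 {}bound] := bound q qd;
  apply/cvgrPdist_le => eta eta0.
  (* Integer case: once [S k] is at most this epsilon, C (S k + epsilon) is at most [eta], while
     r_k^(m - |q|) <= 1 because |q| <= m. *)
  have eps0 : 0 < eta / (2 * C) by rewrite divr_gt0 ?mulr_gt0.
  have {}bound := bound _ eps0.
  have /cvgrPdist_le/(_ _ eps0) S_small := S0.
  have /cvgrPdist_le/(_ _ ltr01) r_small := hr0.
  near=> k; rewrite sub0r normrN.
  have rk1 : r k <= 1.
    by rewrite -(gtr0_norm (hr k)) -normrN -sub0r; near: k.
  have Sk : S k <= eta / (2 * C).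
    by apply: le_trans (ler_norm _) _; rewrite -normrN -sub0r; near: k.
  apply: le_trans (_ : C * (S k + eta / (2 * C)) * r k `^ (m - (\sum_(i < n) q i)%:R) <= _).
    by near: k.
  have {2}-> : eta = C * (eta / (2 * C) + eta / (2 * C)) * 1 by field; rewrite gt_eqF.
  apply: ler_pM; rewrite ?powR_ge0 //.
  - apply: mulr_ge0; first exact: ltW.
    apply: addr_ge0; last exact: ltW.
    apply: mulr_ge0; [exact: powR_ge0|exact: bigmax_ge_id].
  - by rewrite ler_pM2l // lerD2r.
  - by rewrite -[leRHS](powRr0 (r k)) ger_powR ?hr ?rk1 ?subr_ge0.
have M0 : 0 <= M by apply: le_trans (SM 0%N).
have {}bound := bound 1 ltr01.
(* As [m] is not an integer, |q| < m strictly, so r_k^(m - |q|) tends to 0. This makes up for [S]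
   being merely bounded, and the fixed value 1 of epsilon suffices. *)
have q_lt : 0 < m - (\sum_(i < n) q i)%:R.
  rewrite subr_gt0 lt_neqAle qm andbT; apply: contraNneq mNint => <-.
  exact: natr_int.
have B0 : 0 < C * (M + 1) by rewrite mulr_gt0 // ltr_wpDl.
have /cvgrPdist_le/(_ (eta / (C * (M + 1)))) := cvg_powR0 hr hr0 q_lt.
rewrite divr_gt0 // => /(_ isT) r_small.
near=> k; rewrite sub0r normrN.
apply: le_trans (_ : C * (S k + 1) * r k `^ (m - (\sum_(i < n) q i)%:R) <= _).
  by near: k.
apply: le_trans (_ : C * (M + 1) * r k `^ (m - (\sum_(i < n) q i)%:R) <= _).
  rewrite ler_wpM2r ?powR_ge0 // ler_pM2l // lerD2r.
  exact: le_trans (ler_norm _) (SM k).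
rewrite mulrC -ler_pdivlMr // -[leLHS]ger0_norm ?powR_ge0 // -normrN -sub0r.
by near: k.
Unshelve. all: by end_near.
Qed.
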